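(* Let $R$ be a reduced Noetherian ring of positive prime characteristic $p$ and let $N \subseteq M$ be finitely generated $R$-modules. Let $c$ be a locally stable test element for $R$. If there is a test exponent for $c, N, M$, then for every multiplicative system $W$ of $R$, the tight closure $(N_W)^*$ of $N_W$ in $M_W$ over $R_W$ equals $(N^* )_W$ (i.e., tight closure for the pair $N \subseteq M$ commutes with localization).
   Context: Throughout, $q, Q$ denote powers $p^e$, $e \in \mathbb{N}$, of $p$. $R^\circ$ denotes the complement in $R$ of the union of the minimal primes of $R$. $F^e(M)$ denotes the base change of the $R$-module $M$ along the $e$-th iterate $r \mapsto r^{p^e}$ of the Frobenius endomorphism $R \to R$. For $N \subseteq M$ and $q = p^e$, $N^{[q]}$ denotes the image of $F^e(N) \to F^e(M)$, and for $u \in M$, $u^q$ denotes $1 \otimes u \in F^e(M)$. (For an ideal $I \subseteq R$, $I^{[q]}$ is the ideal generated by the $q$-th powers of elements of $I$.) For finitely generated $N \subseteq M$, the tight closure $N^*$ of $N$ in $M$ is the set of $u \in M$ for which there is $c \in R^\circ$ with $cu^q \in N^{[q]}$ for all $q \gg 0$. A test element is an element $c \in R^\circ$ such that for all finitely generated $N \subseteq M$ and $u \in M$: $u \in N^*$ if and only if $cu^q \in N^{[q]}$ for all $q$. It is locally stable if its image in every local ring of $R$ is a test element of that ring. For a test element $c$ of $R$ and finitely generated $N \subseteq M$, a power $q=p^e$ is a test exponent for $c, N, M$ if whenever $u \in M$, $Q \ge q$ is a power of $p$ and $cu^Q \in N^{[Q]}$, then $u \in N^*$. *)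

(* Defs.v *)
From HB Require Import structures.
From mathcomp Require Import all_boot all_algebra boolp ring.

Set Implicit Arguments.
Unset Strict Implicit.
Unset Printing Implicit Defensive.

Import GRing.Theory.

Local Open Scope ring_scope.
Local Open Scope quotient_scope.

(* Rings are [comPzRingType]s rather than [comNzRingType]s because the         *)
(* localization at a multiplicative system containing 0 is the zero ring; this *)
(* rules out the library's [prime_idealr] and [pchar], which need 1 != 0.      *)

Definition submodule (R : pzRingType) (M : lmodType R) (N : submodClosed M) :
  Type := {x : M | x \in N}.

HB.instance Definition _ (R : pzRingType) (M : lmodType R)
  (N : submodClosed M) := SubChoice.on (submodule N).
HB.instance Definition _ (R : pzRingType) (M : lmodType R)
  (N : submodClosed M) := [SubChoice_isSubLmodule of submodule N by <:].

Definition finitely_generated (R : pzRingType) (M : lmodType R) : Prop :=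
  exists s : seq M, forall x : M,
    exists a : 'I_(size s) -> R, x = \sum_(i < size s) a i *: s`_i.

Definition noetherian (R : pzRingType) : Prop :=
  forall I : submodClosed R^o, finitely_generated (submodule I).

Definition reduced (R : pzRingType) : Prop :=
  forall (x : R) (n : nat), x ^+ n = 0 -> x = 0.

Record prime_ideal (R : comPzRingType) := PrimeIdeal {
  prime_set :> {pred R};
  prime_submod : @submod_closed R R^o prime_set;
  prime_proper : 1 \notin prime_set;
  prime_mul : forall x y : R,
    x * y \in prime_set -> (x \in prime_set) || (y \in prime_set)
}.

Definition minimal_prime (R : comPzRingType) (P : prime_ideal R) : Prop :=
  forall P' : prime_ideal R, {subset P' <= P} -> {subset P <= P'}.

(* R^\circ *)
Definition off_minimal_primes (R : comPzRingType) (c : R) : Prop :=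
  forall P : prime_ideal R, minimal_prime P -> c \notin P.

Definition prime_compl (R : comPzRingType) (P : prime_ideal R) : {pred R} :=
  [predC prime_set P].

Fact prime_compl_mulr_closed (R : comPzRingType) (P : prime_ideal R) :
  mulr_closed (prime_compl P).
Proof.
split=> [|x y]; rewrite !inE; first exact: prime_proper.
by move=> nx ny; apply/negP=> /prime_mul; rewrite (negPf nx) (negPf ny).
Qed.

HB.instance Definition _ (R : comPzRingType) (P : prime_ideal R) :=
  GRing.isMulClosed.Build R (prime_compl P) (prime_compl_mulr_closed P).

(* Same body as [pchar], so that [p \in [pchar R]] converts to                 *)
(* [p \in pzchar R] for a nonzero ring R.                                      *)
Definition pzchar (R : pzSemiRingType) : nat_pred :=
  [pred p | prime p & p%:R == 0 :> R].

Section Localization.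
Variables (R : comPzRingType) (W : mulrClosed R).

Definition denom : Type := {w : R | w \in W}.
HB.instance Definition _ := Choice.on denom.

Definition denom1 : denom := exist _ 1 (rpred1 W).
Definition denomM (v w : denom) : denom :=
  exist _ (sval v * sval w) (rpredM (svalP v) (svalP w)).

Section Module.
Variable M : lmodType R.

Definition loc_rel (x y : M * denom) : bool :=
  `[< exists2 t, t \in W & t *: (sval y.2 *: x.1) = t *: (sval x.2 *: y.1) >].

Fact loc_rel_refl : reflexive loc_rel.
Proof. by move=> x; apply/asboolP; exists 1; rewrite ?rpred1. Qed.

Fact loc_rel_sym : symmetric loc_rel.
Proof.
by move=> x y; apply/asboolP/asboolP => -[t tW e]; exists t.
Qed.

Fact loc_rel_trans : transitive loc_rel.
Proof.
move=> [n v] [m u] [k w] /asboolP [s sW es] /asboolP [t tW et].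
apply/asboolP; exists (s * t * sval v).
  by rewrite !rpredM // (svalP v).
move: es et; rewrite /= !scalerA => es et.
have -> : s * t * sval v * sval w = (t * sval w) * (s * sval v) by ring.
rewrite -scalerA es.
have -> : s * t * sval v * sval u = (s * sval u) * (t * sval v) by ring.
rewrite -[RHS]scalerA -et !scalerA. congr (_ *: _). ring.
Qed.

Canonical loc_equiv := EquivRel loc_rel loc_rel_refl loc_rel_sym loc_rel_trans.


Definition locmod : Type := {eq_quot loc_rel}.
HB.instance Definition _ := EqQuotient.on locmod.
HB.instance Definition _ := Choice.on locmod.

(* The fraction u / w. *)
Definition lfrac (u : M) (w : denom) : locmod := \pi_locmod (u, w).

Lemma lfracP (u v : M) (w t : denom) :
  lfrac u w = lfrac v t <->
  exists2 s, s \in W & s *: (sval t *: u) = s *: (sval w *: v).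
Proof. by split=> [/eqmodP /asboolP|h]; last exact/eqmodP/asboolP. Qed.

Lemma lfrac_ex (x : locmod) : {uw : M * denom | x = lfrac uw.1 uw.2}.
Proof. by exists (repr x); rewrite /lfrac -surjective_pairing reprK. Qed.

Definition loc0 : locmod := lfrac 0 denom1.
Definition loc_opp (x : locmod) : locmod :=
  let: (u, w) := repr x in lfrac (- u) w.
Definition loc_add (x y : locmod) : locmod :=
  let: (u, w) := repr x in let: (v, t) := repr y in
  lfrac (sval t *: u + sval w *: v) (denomM w t).

Lemma loc_oppE u w : loc_opp (lfrac u w) = lfrac (- u) w.
Proof.
rewrite /loc_opp; case E: (repr _) => [v t].
have /lfracP [s sW e] : lfrac v t = lfrac u w by rewrite /lfrac -E reprK.
by apply/lfracP; exists s; rewrite // !scalerN e.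
Qed.

Lemma loc_addE u v w t :
  loc_add (lfrac u w) (lfrac v t) =
  lfrac (sval t *: u + sval w *: v) (denomM w t).
Proof.
rewrite /loc_add; case E: (repr _) => [u' w']; case F: (repr _) => [v' t'].
have /lfracP [r rW e] : lfrac u' w' = lfrac u w by rewrite /lfrac -E reprK.
have /lfracP [s sW f] : lfrac v' t' = lfrac v t by rewrite /lfrac -F reprK.
apply/lfracP; exists (r * s); first exact: rpredM.
move: e f; rewrite /= !scalerDr !scalerA => e f; congr (_ + _).
  have -> : r * s * (sval w * sval t) * sval t' =
    (s * sval t * sval t') * (r * sval w) by ring.
  rewrite -scalerA e !scalerA; congr (_ *: _); ring.
have -> : r * s * (sval w * sval t) * sval w' =
  (r * sval w * sval w') * (s * sval t) by ring.
rewrite -scalerA f !scalerA; congr (_ *: _); ring.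
Qed.

Lemma lfrac_eq (u v : M) (w t : denom) :
  sval t *: u = sval w *: v -> lfrac u w = lfrac v t.
Proof. by move=> e; apply/lfracP; exists 1; rewrite ?rpred1 // e. Qed.

Fact loc_addA : associative loc_add.
Proof.
move=> x y z; have [[u w] ->] := lfrac_ex x; have [[v t] ->] := lfrac_ex y.
have [[k s] ->] := lfrac_ex z; rewrite !loc_addE; apply: lfrac_eq => /=.
rewrite !scalerDr !scalerA addrA.
by congr (_ *: _ + _ *: _ + _ *: _); ring.
Qed.

Fact loc_addC : commutative loc_add.
Proof.
move=> x y; have [[u w] ->] := lfrac_ex x; have [[v t] ->] := lfrac_ex y.
rewrite !loc_addE; apply: lfrac_eq => /=.
by rewrite [X in _ = _ *: X]addrC [sval t * _]mulrC.
Qed.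

Fact loc_add0 : left_id loc0 loc_add.
Proof.
move=> x; have [[u w] ->] := lfrac_ex x; rewrite loc_addE; apply: lfrac_eq => /=.
by rewrite scaler0 add0r scale1r mul1r.
Qed.

Fact loc_addN : left_inverse loc0 loc_opp loc_add.
Proof.
move=> x; have [[u w] ->] := lfrac_ex x; rewrite loc_oppE loc_addE.
by apply: lfrac_eq; rewrite /= scalerN addNr !scaler0.
Qed.

HB.instance Definition _ :=
  GRing.isZmodule.Build locmod loc_addA loc_addC loc_add0 loc_addN.

Lemma lfracD u v w t :
  lfrac u w + lfrac v t = lfrac (sval t *: u + sval w *: v) (denomM w t).
Proof. exact: loc_addE. Qed.

End Module.

(* Multiplication of fractions (a / w) (u / t) = (a u) / (w t), used both for  *)
(* the product of R_W and for its action on M_W.                               *)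
Definition loc_scale (M : lmodType R) (a : locmod R^o) (x : locmod M) :
    locmod M :=
  let: (r, w) := repr a in let: (u, t) := repr x in
  lfrac ((r : R) *: u) (denomM w t).

Lemma loc_scaleE (M : lmodType R) (r : R^o) (u : M) w t :
  loc_scale (lfrac r w) (lfrac u t) = lfrac ((r : R) *: u) (denomM w t).
Proof.
rewrite /loc_scale; case E: (repr _) => [r' w']; case F: (repr _) => [u' t'].
have /lfracP [p pW e] : lfrac r' w' = lfrac r w by rewrite /lfrac -E reprK.
have /lfracP [s sW f] : lfrac u' t' = lfrac u t by rewrite /lfrac -F reprK.
apply/lfracP; exists (p * s); first exact: rpredM.
have {}e : p * (sval w * r') = p * (sval w' * r) := e.
move: f; rewrite /= !scalerA => f.
have -> : p * s * (sval w * sval t) * r' = (p * (sval w * r')) * (s * sval t) by ring.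
rewrite -scalerA f e !scalerA; congr (_ *: _); ring.
Qed.

Section Scale.
Variable M : lmodType R.

Fact loc_scaleA (a b : locmod R^o) (x : locmod M) :
  loc_scale a (loc_scale b x) = loc_scale (loc_scale a b) x.
Proof.
have [[r w] ->] := lfrac_ex a; have [[s t] ->] := lfrac_ex b.
have [[u v] ->] := lfrac_ex x; rewrite !loc_scaleE; apply: lfrac_eq => /=.
rewrite !scalerA; congr (_ *: _); rewrite /GRing.scale /=; ring.
Qed.

Fact loc_scale1 : left_id (lfrac (1 : R^o) denom1) (@loc_scale M).
Proof.
move=> x; have [[u v] ->] := lfrac_ex x; rewrite !loc_scaleE.
by apply: lfrac_eq; rewrite /= scale1r mul1r.
Qed.

Fact loc_scaleDr : right_distributive (@loc_scale M) +%R.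
Proof.
move=> a x y; have [[r w] ->] := lfrac_ex a; have [[u t] ->] := lfrac_ex x.
have [[v s] ->] := lfrac_ex y; rewrite !(lfracD, loc_scaleE).
apply: lfrac_eq => /=; rewrite !scalerDr !scalerA.
by congr (_ *: _ + _ *: _); ring.
Qed.

Fact loc_scaleDl (x : locmod M) :
  {morph (@loc_scale M)^~ x : a b / a + b}.
Proof.
move=> a b; have [[r w] ->] := lfrac_ex a; have [[u t] ->] := lfrac_ex b.
have [[v s] ->] := lfrac_ex x; rewrite !(lfracD, loc_scaleE).
apply: lfrac_eq => /=; rewrite scalerDl !scalerDr !scalerA.
by congr (_ *: _ + _ *: _); rewrite /GRing.scale /=; ring.
Qed.

End Scale.

Definition locring : Type := locmod R^o.
HB.instance Definition _ := GRing.Zmodule.on locring.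

Fact loc_mulC : commutative (@loc_scale R^o).
Proof.
move=> a b; have [[r w] ->] := lfrac_ex a; have [[u t] ->] := lfrac_ex b.
by rewrite !loc_scaleE; apply: lfrac_eq; rewrite /GRing.scale /=; ring.
Qed.

Fact loc_mulDl : left_distributive (@loc_scale R^o) +%R.
Proof. by move=> a b x; exact: loc_scaleDl. Qed.

HB.instance Definition _ := GRing.Zmodule_isComPzRing.Build locring
  (@loc_scaleA R^o) loc_mulC (@loc_scale1 R^o) loc_mulDl.

HB.instance Definition _ (M : lmodType R) :=
  GRing.Zmodule_isLmodule.Build locring (locmod M)
    (@loc_scaleA M) (@loc_scale1 M) (@loc_scaleDr M) (@loc_scaleDl M).

End Localization.

Arguments lfrac {R W M} u w.

(* The image c / 1 of c in R_W. *)
Definition to_loc (R : comPzRingType) (W : mulrClosed R) (c : R) : locring W :=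
  lfrac (c : R^o) (denom1 W).

Fact to_loc_nmod_morphism (R : comPzRingType) (W : mulrClosed R) :
  nmod_morphism (@to_loc R W).
Proof.
split=> // x y; rewrite /to_loc lfracD; apply: lfrac_eq.
by rewrite /= !scale1r mulr1 scale1r.
Qed.

Fact to_loc_monoid_morphism (R : comPzRingType) (W : mulrClosed R) :
  monoid_morphism (@to_loc R W).
Proof.
split=> // x y; rewrite /to_loc /GRing.mul /= loc_scaleE; apply: lfrac_eq.
by rewrite /= mulr1.
Qed.

HB.instance Definition _ (R : comPzRingType) (W : mulrClosed R) :=
  GRing.isNmodMorphism.Build R (locring W) (@to_loc R W)
    (@to_loc_nmod_morphism R W).
HB.instance Definition _ (R : comPzRingType) (W : mulrClosed R) :=
  GRing.isMonoidMorphism.Build R (locring W) (@to_loc R W)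
    (@to_loc_monoid_morphism R W).

Fact pzchar_loc (R : comPzRingType) (W : mulrClosed R) (p : nat) :
  p \in pzchar R -> p \in pzchar (locring W).
Proof.
rewrite !inE => /andP[-> /eqP p0] /=.
by rewrite -(rmorph_nat (@to_loc R W)) p0 rmorph0.
Qed.

(* A_W as a subset of M_W. *)
Definition loc_pred (R : comPzRingType) (W : mulrClosed R) (M : lmodType R)
    (A : {pred M}) : {pred locmod W M} :=
  fun x => `[< exists2 u, u \in A & exists w : denom W, x = lfrac u w >].
Arguments loc_pred {R} W {M} A.

Fact loc_pred_submod_closed (R : comPzRingType) (W : mulrClosed R)
  (M : lmodType R) (N : submodClosed M) :
  @submod_closed (locring W) (locmod W M) (loc_pred W N).
Proof.
split; first by apply/asboolP; exists 0; [exact: rpred0 | exists (denom1 W)].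
move=> a x y /asboolP [u uN [w ->]] /asboolP [v vN [t ->]].
have [[r s] ->] := lfrac_ex a; apply/asboolP.
rewrite /GRing.scale /= loc_scaleE lfracD; eexists; last by eexists.
by rewrite rpredD // !rpredZ.
Qed.

HB.instance Definition _ (R : comPzRingType) (W : mulrClosed R)
    (M : lmodType R) (N : submodClosed M) :=
  GRing.isSubmodClosed.Build (locring W) (locmod W M) (loc_pred W N)
    (GRing.submod_closed_semi (loc_pred_submod_closed W N)).

(* Base change S \otimes_R M along phi : R -> S: an element is a formal sum    *)
(* \sum_i s_i \otimes m_i, encoded as the list of the pairs (s_i, m_i).        *)
Section BaseChange.
Variables (R S : comPzRingType) (phi : {rmorphism R -> S}) (M : lmodType R).

Inductive tensor_eq : seq (S * M) -> seq (S * M) -> Prop :=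
| tensor_refl x : tensor_eq x x
| tensor_sym x y : tensor_eq x y -> tensor_eq y x
| tensor_trans x y z : tensor_eq x y -> tensor_eq y z -> tensor_eq x z
| tensor_cat x x' y y' :
    tensor_eq x x' -> tensor_eq y y' -> tensor_eq (x ++ y) (x' ++ y')
| tensor_catC x y : tensor_eq (x ++ y) (y ++ x)
| tensor_0l m : tensor_eq [:: (0, m)] [::]
| tensor_Dl s t m : tensor_eq [:: (s + t, m)] [:: (s, m); (t, m)]
| tensor_Dr s m n : tensor_eq [:: (s, m + n)] [:: (s, m); (s, n)]
| tensor_Z s r m : tensor_eq [:: (s, r *: m)] [:: (s * phi r, m)].

Definition tensor_rel (x y : seq (S * M)) : bool := `[< tensor_eq x y >].

Fact tensor_rel_refl : reflexive tensor_rel.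
Proof. by move=> x; apply/asboolP/tensor_refl. Qed.

Fact tensor_rel_sym : symmetric tensor_rel.
Proof. by move=> x y; apply/asboolP/asboolP => /tensor_sym. Qed.

Fact tensor_rel_trans : transitive tensor_rel.
Proof.
by move=> y x z /asboolP xy /asboolP yz; apply/asboolP/(tensor_trans xy yz).
Qed.

Canonical tensor_equiv :=
  EquivRel tensor_rel tensor_rel_refl tensor_rel_sym tensor_rel_trans.

Definition base_change : Type := {eq_quot tensor_rel}.
HB.instance Definition _ := EqQuotient.on base_change.
HB.instance Definition _ := Choice.on base_change.

(* \sum_i s_i \otimes m_i *)
Definition tensors (x : seq (S * M)) : base_change := \pi_base_change x.

Lemma tensorP (x y : seq (S * M)) :
  tensors x = tensors y <-> tensor_eq x y.
Proof. by split=> [/eqmodP /asboolP|h]; last exact/eqmodP/asboolP. Qed.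

Lemma tensorsK (x : base_change) : tensors (repr x) = x.
Proof. exact: reprK. Qed.

Lemma tensor_repr (x : seq (S * M)) :
  tensor_eq (repr (tensors x)) x.
Proof. by apply/tensorP; rewrite tensorsK. Qed.

Lemma bc_ind (P : base_change -> Prop) :
  (forall x, P (tensors x)) -> forall x, P x.
Proof. by move=> Ppi x; rewrite -[x]tensorsK. Qed.

Definition tensor_scale (a : S) (x : seq (S * M)) : seq (S * M) :=
  [seq (a * sm.1, sm.2) | sm <- x].

Lemma tensor_scale_eq a x y :
  tensor_eq x y -> tensor_eq (tensor_scale a x) (tensor_scale a y).
Proof.
elim=> {x y}
  [x|x y _|x y z _ xy _|x x' y y' _ xx' _ yy'|x y|m|s t m|s m n|s r m].
- exact: tensor_refl.
- exact: tensor_sym.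
- exact: tensor_trans.
- by rewrite /tensor_scale !map_cat; exact: tensor_cat.
- by rewrite /tensor_scale !map_cat; exact: tensor_catC.
- by rewrite /= mulr0; exact: tensor_0l.
- by rewrite /= mulrDr; exact: tensor_Dl.
- exact: tensor_Dr.
- by rewrite /= mulrA; exact: tensor_Z.
Qed.

Definition bc_add (x y : base_change) : base_change :=
  tensors (repr x ++ repr y).
Definition bc_scale (a : S) (x : base_change) : base_change :=
  tensors (tensor_scale a (repr x)).

Lemma bc_addE x y :
  bc_add (tensors x) (tensors y) = tensors (x ++ y).
Proof. by apply/tensorP/tensor_cat; exact: tensor_repr. Qed.

Lemma bc_scaleE a x :
  bc_scale a (tensors x) = tensors (tensor_scale a x).
Proof. by apply/tensorP/tensor_scale_eq/tensor_repr. Qed.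

Fact bc_addA : associative bc_add.
Proof.
move=> x y z; elim/bc_ind: x => x; elim/bc_ind: y => y; elim/bc_ind: z => z.
by rewrite !bc_addE catA.
Qed.

Fact bc_addC : commutative bc_add.
Proof. by move=> x y; elim/bc_ind: x => x; elim/bc_ind: y => y; rewrite !bc_addE; apply/tensorP/tensor_catC. Qed.

Fact bc_add0 : left_id (tensors [::]) bc_add.
Proof. by move=> x; elim/bc_ind: x => x; rewrite bc_addE. Qed.

Fact bc_addN : left_inverse (tensors [::]) (bc_scale (- 1)) bc_add.
Proof.
move=> x; elim/bc_ind: x => x; rewrite bc_scaleE bc_addE; apply/tensorP.
elim: x => [|[s m] x IHx]; first exact: tensor_refl.
rewrite -cat1s /tensor_scale map_cat -/(tensor_scale _ x) -/(tensor_scale _ [:: _]).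
set y := tensor_scale _ x; set z := tensor_scale _ _.
have zy : tensor_eq (z ++ y ++ [:: (s, m)] ++ x) (z ++ [:: (s, m)] ++ y ++ x).
  apply: tensor_cat; first exact: tensor_refl.
  rewrite !catA; apply: tensor_cat; last exact: tensor_refl.
  exact: tensor_catC.
rewrite -catA; apply: (tensor_trans zy).
have /tensor_cat : tensor_eq (z ++ [:: (s, m)]) [::].
  apply: tensor_trans (tensor_0l m).
  rewrite -(addNr s) /z /= mulN1r.
  exact: tensor_sym (tensor_Dl _ _ _).
by move=> /(_ _ _ IHx); rewrite -!catA.
Qed.

HB.instance Definition _ :=
  GRing.isZmodule.Build base_change bc_addA bc_addC bc_add0 bc_addN.

Fact bc_scaleA a b x : bc_scale a (bc_scale b x) = bc_scale (a * b) x.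
Proof.
elim/bc_ind: x => x; rewrite !bc_scaleE /tensor_scale -map_comp.
by congr tensors; apply: eq_map => sm /=; rewrite mulrA.
Qed.

Fact bc_scale1 : left_id 1 bc_scale.
Proof.
move=> x; elim/bc_ind: x => x; rewrite bc_scaleE /tensor_scale; congr tensors.
by rewrite -[RHS]map_id; apply: eq_map => -[s m] /=; rewrite mul1r.
Qed.

Fact bc_scaleDr : right_distributive bc_scale +%R.
Proof.
move=> a; move=> x y; elim/bc_ind: x => x; elim/bc_ind: y => y.
by rewrite /GRing.add /= !(bc_addE, bc_scaleE) /tensor_scale map_cat.
Qed.

Fact bc_scaleDl x : {morph bc_scale^~ x : a b / a + b}.
Proof.
move=> a b; elim/bc_ind: x => x; rewrite /GRing.add /= !(bc_scaleE, bc_addE).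
apply/tensorP; elim: x => [|[s m] x IHx]; first exact: tensor_refl.
have /tensor_cat /(_ IHx) : tensor_eq [:: ((a + b) * s, m)]
    ([:: (a * s, m)] ++ [:: (b * s, m)]).
  by rewrite mulrDl; exact: tensor_Dl.
move=> /tensor_trans; apply; rewrite -catA [tensor_scale a (_ :: _)]/=.
rewrite -[_ :: tensor_scale a x]cat1s -catA.
apply: tensor_cat; first exact: tensor_refl.
rewrite [tensor_scale b (_ :: _)]/= -[_ :: tensor_scale b x]cat1s !catA.
by apply: tensor_cat; [exact: tensor_catC | exact: tensor_refl].
Qed.

HB.instance Definition _ := GRing.Zmodule_isLmodule.Build S base_change
  bc_scaleA bc_scale1 bc_scaleDr bc_scaleDl.

Lemma tensorsD x y : tensors x + tensors y = tensors (x ++ y).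
Proof. exact: bc_addE. Qed.

Lemma tensorsZ a x : a *: tensors x = tensors (tensor_scale a x).
Proof. exact: bc_scaleE. Qed.

(* s \otimes m *)
Definition tensor (s : S) (m : M) : base_change := tensors [:: (s, m)].

End BaseChange.

Section BaseChangeMap.
Variables (R S : comPzRingType) (phi : {rmorphism R -> S}).
Variables (M N : lmodType R) (f : {linear M -> N}).

(* S \otimes f *)
Definition bc_map (x : base_change phi M) : base_change phi N :=
  tensors phi [seq (sm.1, f sm.2) | sm <- repr x].

Lemma bc_map_eq (x y : seq (S * M)) :
  tensor_eq phi x y ->
  tensor_eq phi [seq (sm.1, f sm.2) | sm <- x] [seq (sm.1, f sm.2) | sm <- y].
Proof.
elim=> {x y}
  [x|x y _|x y z _ xy _|x x' y y' _ xx' _ yy'|x y|m|s t m|s m n|s r m].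
- exact: tensor_refl.
- exact: tensor_sym.
- exact: tensor_trans.
- by rewrite !map_cat; exact: tensor_cat.
- by rewrite !map_cat; exact: tensor_catC.
- exact: tensor_0l.
- exact: tensor_Dl.
- by rewrite /= raddfD; exact: tensor_Dr.
- by rewrite /= linearZ; exact: tensor_Z.
Qed.

Lemma bc_mapE (x : seq (S * M)) :
  bc_map (tensors phi x) = tensors phi [seq (sm.1, f sm.2) | sm <- x].
Proof. exact/tensorP/bc_map_eq/tensor_repr. Qed.

Fact bc_map_linear : linear bc_map.
Proof.
move=> a x y; rewrite -[x]tensorsK -[y]tensorsK.
move: (repr x) (repr y) => {}x {}y.
rewrite tensorsZ tensorsD !bc_mapE tensorsZ tensorsD; congr tensors.
by rewrite map_cat /tensor_scale -!map_comp.
Qed.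

HB.instance Definition _ :=
  GRing.isLinear.Build S (base_change phi M) (base_change phi N) _ bc_map
    bc_map_linear.

End BaseChangeMap.

Section TightClosure.
Variables (R : comPzRingType) (p : nat).

Definition frob of p \in pzchar R := fun (e : nat) (r : R) => r ^+ (p ^ e).

Hypothesis chRp : p \in pzchar R.

Fact frob_nmod_morphism e : nmod_morphism (frob chRp e).
Proof.
have /andP[p_pr /eqP p0] : prime p && (p%:R == 0 :> R) by [].
split=> [|x y]; first by rewrite /frob expr0n eqn0Ngt expn_gt0 prime_gt0.
rewrite /frob; elim: e => [|e IHe]; first by rewrite !expr1.
rewrite expnSr !exprM IHe; move: {IHe}(x ^+ _) (y ^+ _) => {}x {}y.
have defp := prednK (prime_gt0 p_pr).
rewrite exprDn big_ord_recr subnn -defp big_ord_recl /= defp.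
rewrite subn0 mulr1 mul1r bin0 binn big1 ?addr0 // => i _.
have /dvdnP[k ->] : (p %| 'C(p, bump 0 i))%N.
  by rewrite prime_dvd_bin //= -{2}defp ltnS (valP i).
by rewrite mulrnA -mulr_natr p0 mulr0.
Qed.

Fact frob_monoid_morphism e : monoid_morphism (frob chRp e).
Proof. by split=> [|x y]; rewrite /frob ?expr1n // exprMn. Qed.

HB.instance Definition _ e :=
  GRing.isNmodMorphism.Build R R (frob chRp e) (frob_nmod_morphism e).
HB.instance Definition _ e :=
  GRing.isMonoidMorphism.Build R R (frob chRp e) (frob_monoid_morphism e).

(* F^e(M) *)
Definition frob_mod (e : nat) (M : lmodType R) : lmodType R :=
  base_change (frob chRp e) M.

(* u^q for q = p ^ e *)
Definition frob_elt (e : nat) (M : lmodType R) (u : M) : frob_mod e M :=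
  tensor (frob chRp e) 1 u.

(* N^[q] for q = p ^ e *)
Definition frob_pow (e : nat) (M : lmodType R) (N : submodClosed M) :
    {pred frob_mod e M} :=
  fun y => `[< exists x : frob_mod e (submodule N),
    y = bc_map (val : {linear submodule N -> M}) x >].
Arguments frob_pow e {M} N.

Definition tight_closure (M : lmodType R) (N : submodClosed M) : {pred M} :=
  fun u => `[< exists2 c : R, off_minimal_primes c &
    exists e0, forall e, (e0 <= e)%N -> c *: frob_elt e u \in frob_pow e N >].

Definition test_element (c : R) : Prop :=
  off_minimal_primes c /\
  forall (M : lmodType R) (N : submodClosed M),
    finitely_generated M -> finitely_generated (submodule N) ->
    forall u : M, u \in tight_closure N <->
      forall e, c *: frob_elt e u \in frob_pow e N.

(* p ^ e is a test exponent for c, N, M *)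
Definition test_exponent (c : R) (M : lmodType R) (N : submodClosed M)
    (e : nat) : Prop :=
  forall (u : M) (E : nat), (p ^ e <= p ^ E)%N ->
    c *: frob_elt E u \in frob_pow E N -> u \in tight_closure N.

End TightClosure.

Definition locally_stable (R : comPzRingType) (p : nat)
    (chRp : p \in pzchar R) (c : R) : Prop :=
  forall P : prime_ideal R,
    test_element (pzchar_loc (prime_compl P) chRp) (to_loc (prime_compl P) c).

(* Main.v *)
(* The element (a / t) (u / w)^q lies in (N_W)^[q] over R_W iff some multiple *)
(* v a u^q with v in W lies in N^[q], and a / t is off the minimal primes of  *)
(* R_W iff a avoids the minimal primes of R disjoint from W. Hence tight      *)
(* closure of N always localizes into that of N_W, and membership of u / w in *)
(* (N_W)^* persists in further localizations. If the ideal of the r with r c  *)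
(* u^q in N^[q] missed W, it would be contained in a prime P disjoint from W; *)
(* but u is in (N_P)^* and c is a test element of R_P, so this ideal is not   *)
(* contained in P. Thus v c u^q is in N^[q] for some v in W, so is c (v u)^q, *)
(* and taking q to be a test exponent gives v u in N^*.                       *)

Require Import Defs.
From HB Require Import structures.
From mathcomp Require Import all_boot all_algebra ring.
From mathcomp Require Import boolp classical_sets.

Set Implicit Arguments.
Unset Strict Implicit.
Unset Printing Implicit Defensive.

Import GRing.Theory.

Local Open Scope ring_scope.

(** A multiplier witnessing u in the tight closure of N still works after localizing
    ([tight_closure_loc]), which gives one inclusion without the test exponent.

    For the other, let u / w lie in the tight closure of N_W and fix q. At a prime P disjoint from
    W, u / 1 lies in the tight closure of N_P ([tight_closure_loc_sub]), and c / 1 is a test element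
    of R_P, so s c u^q is in N^[q] for some s outside P. Hence the ideal of all r with r c u^q in
    N^[q] lies in no prime disjoint from W, and by [disjoint_ideal_sub_prime] it contains some v in
    W; this is [locally_stable_frob_pow]. Multiplying by v^(q-1) puts c (v u)^q in N^[q]. Here v
    depends on q, but a single q is enough when q is a test exponent: v u is in the tight closure of
    N, and u / w = (v u) / (v w).

    Two dictionaries support this: Frobenius powers commute with localization ([frob_pow_loc],
    [frob_pow_loc_ex]), and the minimal primes of R_W are those of R that miss W
    ([off_minimal_primes_lfrac]). *)

Lemma submod_closed_mul (R : comPzRingType) (I : {pred R}) (a x : R) :
  @submod_closed R R^o I -> x \in I -> a * x \in I.
Proof. by case=> I0 Icl xI; have := Icl a x 0 xI I0; rewrite addr0. Qed.

Lemma submod_closed_add (R : comPzRingType) (I : {pred R}) (x y : R) :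
  @submod_closed R R^o I -> x \in I -> y \in I -> x + y \in I.
Proof. by case=> I0 Icl xI yI; have := Icl 1 x y xI yI; rewrite scale1r. Qed.

(** * Ideals and primes disjoint from a multiplicative system *)

Section DisjointPrimes.
Variables (R : comPzRingType) (W : mulrClosed R).

Definition disjoint_ideal (I : pred R) : Prop :=
  @submod_closed R R^o I /\ forall w, w \in W -> w \notin I.

(** Zorn's lemma: the union of a nonempty chain of ideals that contain I and miss W is again such an
    ideal. *)
Lemma disjoint_ideal_maximal (I : pred R) : disjoint_ideal I ->
  exists P : pred R, [/\ disjoint_ideal P, {subset I <= P} &
    forall J : pred R, disjoint_ideal J -> {subset P <= J} -> {subset J <= P}].
Proof.
move=> avI; pose T := {J : R -> bool | disjoint_ideal J /\ {subset I <= J}}.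
pose le (J K : T) := `[< {subset (sval J : pred R) <= (sval K : pred R)} >].
have le_refl J : le J J by apply/asboolP => x.
have le_trans J K L : le J K -> le K L -> le J L.
  by move=> /asboolP JK /asboolP KL; apply/asboolP => x /JK /KL.
(* I itself bounds the empty chain, whose union would not contain I. *)
pose T0 : T := exist _ I (conj avI (fun x xI => xI)).
have ub (A : set T) : total_on A (fun J K => le J K) ->
    exists t, forall s, A s -> le s t.
  move=> Atot; have [[J0 AJ0]|A0] := pselect (exists J, A J); last first.
    by exists T0 => s As; case: A0; exists s.
  pose U : R -> bool := fun x =>
    `[< exists2 J, A J & x \in (sval J : pred R) >].
  have avU : disjoint_ideal U /\ {subset I <= U}.
    split; last first.
      move=> x xI; apply/asboolP; exists J0 => //.
      by have [_] := svalP J0; apply.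
    split; first split.
    - apply/asboolP; exists J0 => //.
      by have [[[J00 _] _] _] := svalP J0.
    - move=> a x y /asboolP[J AJ xJ] /asboolP[K AK yK]; apply/asboolP.
      have [/asboolP JK|/asboolP KJ] := Atot J K AJ AK.
        by exists K => //; have [[[_ cl] _] _] := svalP K;
          apply: cl => //; exact: JK.
      by exists J => //; have [[[_ cl] _] _] := svalP J;
        apply: cl => //; exact: KJ.
    - move=> w wW; apply/negP => /asboolP[J _]; have [[_ dis] _] := svalP J.
      exact/negP/dis.
  exists (exist _ U avU) => J AJ; apply/asboolP => x xJ.
  by apply/asboolP; exists J.
have [[P [avP IP]] Pmax] := ZL_preorder T0 le_refl le_trans ub.
exists P; split=> // J avJ PJ.
have avIJ : disjoint_ideal J /\ {subset I <= J} by split=> // x /IP /PJ.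
by have /asboolP := Pmax (exist _ (J : R -> bool) avIJ) (asboolT PJ).
Qed.

(** An ideal maximal among those missing W is prime: if x and y are outside P, then P + R x and P +
    R y both meet W, hence so does P + R x y, and x y cannot be in P. *)
Lemma disjoint_ideal_sub_prime (I : pred R) : disjoint_ideal I ->
  exists2 P : prime_ideal R, {subset I <= P} & forall w, w \in W -> w \notin P.
Proof.
move=> /disjoint_ideal_maximal[P [[Pcl Pdis] IP Pmax]].
have Padd := submod_closed_add Pcl; have Pmul := submod_closed_mul _ Pcl.
have meet x : x \notin P -> exists2 a, a \in P & exists r, a + r * x \in W.
  move=> xP; apply: contrapT => noW; move/negP: xP; apply.
  (* The ideal P + R x; if it missed W, maximality would put x in P. *)
  pose K : pred R := fun y =>
    `[< exists2 a, a \in P & exists r, y = a + r * x >].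
  have KI y : y \in K <-> exists2 a, a \in P & exists r, y = a + r * x.
    by split=> /asboolP.
  apply: (Pmax K).
  - split; first split.
    + by apply/KI; exists 0; [exact: Pcl.1 | exists 0; rewrite mul0r addr0].
    + move=> a _ _ /KI[b bP [r ->]] /KI[d dP [s ->]]; apply/KI.
      exists (a * b + d); first by apply: Padd => //; exact: Pmul.
      by exists (a * r + s); rewrite /GRing.scale /=; ring.
    + move=> w wW; apply/negP => /KI[a aP [r wE]].
      by apply: noW; exists a => //; exists r; rewrite -wE.
  - by move=> a aP; apply/KI; exists a => //; exists 0; rewrite mul0r addr0.
  - by apply/KI; exists 0; [exact: Pcl.1 | exists 1; rewrite mul1r add0r].
have Pprime x y : x * y \in P -> (x \in P) || (y \in P).
  move=> xyP; apply: contraT; rewrite negb_or.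
  move=> /andP[/meet[a aP [r arW]] /meet[b bP [s bsW]]].
  have /negP[] := Pdis _ (rpredM arW bsW).
  have -> : (a + r * x) * (b + s * y) =
    (b + s * y) * a + (r * x * b + r * s * (x * y)) by ring.
  by apply/Padd/Padd; exact: Pmul.
have P1 : 1 \notin P by apply: Pdis; exact: rpred1.
by exists (PrimeIdeal Pcl P1 Pprime).
Qed.

End DisjointPrimes.

Definition prime_submodClosed (R : comPzRingType) (P : prime_ideal R) :
    submodClosed R^o :=
  HB.pack (prime_set P : {pred R^o})
    (GRing.isSubmodClosed.Build R R^o (prime_set P)
      (GRing.submod_closed_semi (prime_submod P))).

(** * Primes of R_W and primes of R disjoint from W *)

Section LocalizationPrimes.
Variables (R : comPzRingType) (W : mulrClosed R).

Lemma to_loc_mul_lfrac (r : R) (M : lmodType R) (u : M) (w : denom W) :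
  to_loc W r *: lfrac u w = lfrac (r *: u) w.
Proof.
rewrite /GRing.scale /= loc_scaleE; apply: lfrac_eq.
by rewrite /= mul1r.
Qed.

Lemma denom_mul_lfrac (M : lmodType R) (u : M) (w : denom W) :
  to_loc W (sval w) *: lfrac u w = lfrac u (denom1 W).
Proof.
by rewrite to_loc_mul_lfrac; apply: lfrac_eq; rewrite /= scale1r.
Qed.

Lemma lfrac_scale_inv (M : lmodType R) (u : M) (w : denom W) :
  lfrac u w = (lfrac (1 : R^o) w : locring W) *: lfrac u (denom1 W).
Proof.
rewrite /GRing.scale /= loc_scaleE; apply: lfrac_eq.
by rewrite /= mulr1 scale1r.
Qed.

(** Denominators are units of R_W, so ideals of R_W only see numerators. *)
Lemma mem_lfrac (I : {pred locring W}) (r : R^o) (w : denom W) :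
  @submod_closed (locring W) (locring W)^o I ->
  (lfrac r w \in I) = (to_loc W r \in I).
Proof.
move=> Icl; apply/idP/idP => rI.
  by rewrite /to_loc -(denom_mul_lfrac r w); exact: submod_closed_mul Icl rI.
by rewrite lfrac_scale_inv; exact: submod_closed_mul Icl rI.
Qed.

Definition contraction_pred (Q : prime_ideal (locring W)) : {pred R} :=
  [pred r | to_loc W r \in Q].

Fact contraction_submod_closed (Q : prime_ideal (locring W)) :
  @submod_closed R R^o (contraction_pred Q).
Proof.
have Qcl := prime_submod Q; split; first by rewrite inE rmorph0; exact: Qcl.1.
move=> a x y; rewrite !inE => xQ yQ; rewrite rmorphD /= rmorphM /=.
exact/(submod_closed_add Qcl)/yQ/(submod_closed_mul _ Qcl).
Qed.

Fact contraction_proper (Q : prime_ideal (locring W)) :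
  1 \notin contraction_pred Q.
Proof. by rewrite inE rmorph1; exact: prime_proper. Qed.

Fact contraction_mul (Q : prime_ideal (locring W)) (x y : R) :
  x * y \in contraction_pred Q ->
  (x \in contraction_pred Q) || (y \in contraction_pred Q).
Proof. by rewrite !inE rmorphM; exact: prime_mul. Qed.

Definition contraction (Q : prime_ideal (locring W)) : prime_ideal R :=
  PrimeIdeal (contraction_submod_closed Q) (contraction_proper Q)
    (@contraction_mul Q).

Lemma contractionE (Q : prime_ideal (locring W)) (r : R) :
  (r \in contraction Q) = (to_loc W r \in Q).
Proof. by []. Qed.

Lemma contraction_disjoint (Q : prime_ideal (locring W)) (w : R) :
  w \in W -> w \notin contraction Q.
Proof.
move=> wW; rewrite contractionE; apply: contra (prime_proper Q) => wQ.
have -> : 1 = to_loc W w * lfrac (1 : R^o) (exist _ w wW) :> locring W.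
  exact: esym (denom_mul_lfrac (1 : R^o) (exist _ w wW)).
by rewrite mulrC; apply: submod_closed_mul wQ; exact: prime_submod.
Qed.

Variables (P : prime_ideal R) (PW : forall w, w \in W -> w \notin P).

Definition extension_pred : {pred locring W} :=
  loc_pred W (prime_submodClosed P).

(** Primality of P cancels the elements of W that appear when fractions are compared, since none of
    them is in P. *)
Lemma mem_extension (r : R^o) (w : denom W) :
  (lfrac r w \in extension_pred) = (r \in P).
Proof.
apply/asboolP/idP => [[s sP [t /lfracP[v vW e]]]|rP]; last first.
  by exists r => //; exists w.
have : v * (sval t * r) \in P.
  have -> : v * (sval t * r) = v * (sval w * s) := e.
  by rewrite mulrA; apply: submod_closed_mul sP; exact: prime_submod.
have vP := negPf (PW vW); have tP := negPf (PW (svalP t)).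
by move=> /prime_mul; rewrite vP => /prime_mul; rewrite tP.
Qed.

Fact extension_submod_closed :
  @submod_closed (locring W) (locring W)^o extension_pred.
Proof.
have [I0 Icl] := @loc_pred_submod_closed R W R^o (prime_submodClosed P).
split; first exact: I0.
exact: Icl.
Qed.

Fact extension_proper : 1 \notin extension_pred.
Proof. by rewrite mem_extension; exact: prime_proper. Qed.

Fact extension_mul (x y : locring W) : x * y \in extension_pred ->
  (x \in extension_pred) || (y \in extension_pred).
Proof.
have [[r w] ->] := lfrac_ex x; have [[s t] ->] := lfrac_ex y.
by rewrite /GRing.mul /= loc_scaleE !mem_extension => /prime_mul.
Qed.

Definition extension : prime_ideal (locring W) :=
  PrimeIdeal extension_submod_closed extension_proper extension_mul.

Lemma extensionE (r : R^o) (w : denom W) :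
  (lfrac r w \in extension) = (r \in P).
Proof. exact: mem_extension. Qed.

End LocalizationPrimes.

(** Contraction and extension are inclusion-preserving inverse bijections between the primes of R_W
    and the primes of R missing W, so they match the minimal ones. *)
Lemma off_minimal_primes_lfrac (R : comPzRingType) (W : mulrClosed R)
    (r : R) (w : denom W) :
  off_minimal_primes (lfrac (r : R^o) w : locring W) <->
  forall P : prime_ideal R, minimal_prime P ->
    (forall v, v \in W -> v \notin P) -> r \notin P.
Proof.
split=> [off P Pmin PW|off Q Qmin].
  rewrite -(extensionE PW r w); apply: off => Q QP x.
  have [[s v] ->] := lfrac_ex x; rewrite extensionE => sP.
  rewrite mem_lfrac; last exact: prime_submod.
  rewrite -contractionE; apply: Pmin sP => y; rewrite contractionE => /QP.
  by rewrite extensionE.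
rewrite mem_lfrac; last exact: prime_submod.
rewrite -contractionE; apply: off; last exact: contraction_disjoint.
move=> P PQ y yQ.
(* A prime below the contraction of Q also misses W, so it extends to R_W, where minimality of Q
   applies. *)
have PW v : v \in W -> v \notin P.
  by move=> /(contraction_disjoint Q); apply: contra; exact: PQ.
rewrite -(extensionE PW y (denom1 W)); apply: Qmin yQ => x.
have [[s v] ->] := lfrac_ex x; rewrite extensionE => /PQ.
rewrite mem_lfrac //; exact: prime_submod.
Qed.

(** * Base change through sums of pure tensors *)

Section BaseChangeSums.
Variables (R S : comPzRingType) (phi : {rmorphism R -> S}) (M : lmodType R).

(** The universal property of the tensor product: a balanced biadditive map is constant on the
    classes of formal sums. It serves to define maps out of a base change. *)
Lemma tensor_eq_sum (Z : zmodType) (f : S -> M -> Z) (x y : seq (S * M)) :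
  (forall s t m, f (s + t) m = f s m + f t m) ->
  (forall s m n, f s (m + n) = f s m + f s n) ->
  (forall s r m, f s (r *: m) = f (s * phi r) m) ->
  tensor_eq phi x y ->
  \sum_(sm <- x) f sm.1 sm.2 = \sum_(sm <- y) f sm.1 sm.2.
Proof.
move=> fDl fDr fZ; elim=> {x y}
  [//|x y _ ->//|x y z _ -> _ ->//
  |x x' y y' _ xx' _ yy'|x y|m|s t m|s m n|s r m].
- by rewrite !big_cat xx' yy'.
- by rewrite !big_cat /= addrC.
(* Additivity forces f 0 m = 0. *)
- rewrite big_seq1 big_nil /=; apply: (addrI (f 0 m)).
  by rewrite -fDl !addr0.
- by rewrite !big_cons !big_nil !addr0 fDl.
- by rewrite !big_cons !big_nil !addr0 fDr.
- by rewrite !big_seq1 fZ.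
Qed.

Lemma tensors_sum (x : seq (S * M)) :
  tensors phi x = \sum_(sm <- x) tensor phi sm.1 sm.2.
Proof.
elim: x => [|[s m] x IHx]; first by rewrite big_nil.
by rewrite big_cons -IHx -[RHS]/(tensors _ _ + _) tensorsD.
Qed.

Lemma tensorDl s t (m : M) :
  tensor phi (s + t) m = tensor phi s m + tensor phi t m.
Proof.
by rewrite -[RHS]/(tensors _ _ + _) tensorsD; apply/tensorP/tensor_Dl.
Qed.

Lemma tensorDr s (m n : M) :
  tensor phi s (m + n) = tensor phi s m + tensor phi s n.
Proof.
by rewrite -[RHS]/(tensors _ _ + _) tensorsD; apply/tensorP/tensor_Dr.
Qed.

Lemma tensorZr s r (m : M) : tensor phi s (r *: m) = tensor phi (s * phi r) m.
Proof. exact/tensorP/tensor_Z. Qed.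

Lemma tensorZl a s (m : M) : a *: tensor phi s m = tensor phi (a * s) m.
Proof. exact: tensorsZ. Qed.

End BaseChangeSums.

Arguments frob_pow [R p] chRp e [M] N _.

(** * The Frobenius powers N^[q] *)

Section FrobeniusPowers.
Variables (R : comPzRingType) (p : nat) (chRp : p \in pzchar R) (e : nat).
Variables (M : lmodType R) (N : submodClosed M).

Lemma frob_powP (y : frob_mod chRp e M) :
  y \in frob_pow chRp e N <->
  exists2 l : seq (R * M), all (fun sm => sm.2 \in N) l &
    y = \sum_(sm <- l) tensor (frob chRp e) sm.1 sm.2.
Proof.
split=> [/asboolP[x ->]|[l lN ->]].
  rewrite -[x]tensorsK bc_mapE tensors_sum; eexists; last by [].
  by rewrite all_map; apply/allP => -[s [m mN]] _.
apply/asboolP; elim: l lN => [_|[s m] l IHl /= /andP[mN /IHl[x xE]]].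
  by exists 0; rewrite raddf0 big_nil.
pose m' : submodule N := exist _ m mN.
exists (tensor _ s m' + x); rewrite raddfD /= -xE big_cons; congr (_ + _).
by rewrite [RHS]bc_mapE.
Qed.

Fact frob_pow_submod_closed : submod_closed (frob_pow chRp e N).
Proof.
split; first by apply/frob_powP; exists [::]; rewrite ?big_nil.
move=> a x y /frob_powP[k kN ->] /frob_powP[l lN ->]; apply/frob_powP.
exists ([seq (a * sm.1, sm.2) | sm <- k] ++ l).
  by rewrite all_cat all_map kN.
rewrite big_cat big_map scaler_sumr; congr (_ + _).
by apply: eq_bigr => sm _; rewrite tensorZl.
Qed.

HB.instance Definition _ :=
  GRing.isSubmodClosed.Build R (frob_mod chRp e M) (frob_pow chRp e N)
    (GRing.submod_closed_semi frob_pow_submod_closed).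

Lemma mem_frob_pow_tensor s m : m \in N ->
  tensor (frob chRp e) s m \in frob_pow chRp e N.
Proof.
by move=> mN; apply/frob_powP; exists [:: (s, m)]; rewrite ?big_seq1 //= mN.
Qed.

Lemma scale_frob_elt (r : R) (u : M) :
  frob_elt chRp e (r *: u) = (r ^+ (p ^ e)) *: frob_elt chRp e u.
Proof. by rewrite /frob_elt tensorZr tensorZl mul1r mulr1. Qed.

End FrobeniusPowers.

(** * Frobenius powers commute with localization *)

Section FrobeniusLocalization.
Variables (R : comPzRingType) (p : nat) (chRp : p \in pzchar R) (e : nat).
Variables (W : mulrClosed R) (M : lmodType R) (N : submodClosed M).

Let chWp := pzchar_loc W chRp.
Let phi := frob chRp e.
Let phiW := frob chWp e.

Definition denomX (w : denom W) (n : nat) : denom W :=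
  exist _ (sval w ^+ n) (rpredX n (svalP w)).

Lemma to_locX_frob (r : R) : phiW (to_loc W r) = to_loc W (phi r).
Proof. by rewrite /phiW /phi /frob rmorphXn. Qed.

Lemma lfracM (r s : R^o) (w t : denom W) :
  (lfrac r w : locring W) * (lfrac s t : locring W) =
  lfrac ((r : R) * s : R^o) (denomM w t).
Proof. exact: loc_scaleE. Qed.

Lemma lfracX (r : R^o) (w : denom W) n :
  (lfrac r w : locring W) ^+ n = lfrac ((r : R) ^+ n : R^o) (denomX w n).
Proof.
elim: n => [|n IHn]; first exact: lfrac_eq.
rewrite exprS IHn lfracM; apply: lfrac_eq => /=.
by rewrite /GRing.scale /= !exprS; ring.
Qed.

(* F^e(M) -> F^e(M_W), r \otimes m |-> (r / 1) \otimes (m / 1) *)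
Lemma loc_frob_sum (k l : seq (R * M)) :
  \sum_(sm <- k) tensor phi sm.1 sm.2 = \sum_(sm <- l) tensor phi sm.1 sm.2 ->
  \sum_(sm <- k) tensor phiW (to_loc W sm.1) (lfrac sm.2 (denom1 W)) =
  \sum_(sm <- l) tensor phiW (to_loc W sm.1) (lfrac sm.2 (denom1 W)).
Proof.
rewrite -!tensors_sum => /tensorP.
apply: (tensor_eq_sum
  (f := fun s m => tensor phiW (to_loc W s) (lfrac m (denom1 W)))).
- by move=> s t m; rewrite rmorphD tensorDl.
- move=> s m n; rewrite -tensorDr; congr tensor.
  by rewrite lfracD; apply: lfrac_eq; rewrite /= !scale1r mulr1 scale1r.
- move=> s r m; rewrite -to_loc_mul_lfrac tensorZr rmorphM /=.
  by congr (tensor _ (_ * _) _); exact: to_locX_frob.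
Qed.

(** The expression of v r u^q as a sum of tensors over N is carried to F^e(M_W) by [loc_frob_sum];
    then v, t and w^q, now units, are divided out. *)
Lemma frob_pow_loc (r : R) (u : M) (w t : denom W) (v : R) :
  v \in W -> v *: (r *: frob_elt chRp e u) \in frob_pow chRp e N ->
  (lfrac (r : R^o) t : locring W) *: frob_elt chWp e (lfrac u w) \in
    frob_pow chWp e (loc_pred W N).
Proof.
move=> vW /frob_powP[l lN].
rewrite scalerA tensorZl mulr1 => lE.
have /loc_frob_sum : \sum_(sm <- [:: (v * r, u)]) tensor phi sm.1 sm.2 =
  \sum_(sm <- l) tensor phi sm.1 sm.2 by rewrite big_seq1.
rewrite big_seq1 /= => E.
have mem : tensor phiW (to_loc W (v * r)) (lfrac u (denom1 W)) \in
    frob_pow chWp e (loc_pred W N).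
  rewrite E big_seq rpred_sum // => -[s m] sml; apply: mem_frob_pow_tensor.
  by apply/asboolP; exists m; [exact: (allP lN _ sml) | exists (denom1 W)].
rewrite (lfrac_scale_inv u w) scale_frob_elt scalerA.
set b := (X in _ * X).
have -> : (lfrac (r : R^o) t : locring W) * b =
    b * (lfrac (1 : R^o) t : locring W)
      * (lfrac (1 : R^o) (exist _ v vW) : locring W)
      * to_loc W (v * r).
  rewrite mulrC -!mulrA; congr (_ * _).
  rewrite /to_loc !lfracM; apply: lfrac_eq => /=.
  by rewrite /GRing.scale /=; ring.
by rewrite -scalerA tensorZl mulr1 rpredZ.
Qed.

(** On pure tensors, the natural map from F^e(M_W) to F^e(M)_W. The denominator w of x enters as w^q
    because 1 / w crosses the tensor sign through Frobenius. *)
Definition loc_tensor (a : locring W) (x : locmod W M) :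
    locmod W (frob_mod chRp e M) :=
  let: (r, s) := repr (a : locmod W R^o) in let: (m, w) := repr x in
  lfrac (tensor phi (r : R) m) (denomM s (denomX w (p ^ e))).

Lemma loc_tensorE (r : R^o) (s : denom W) (m : M) (w : denom W) :
  loc_tensor (lfrac r s) (lfrac m w) =
  lfrac (tensor phi (r : R) m) (denomM s (denomX w (p ^ e))).
Proof.
rewrite /loc_tensor; case E: (repr _) => [r' s']; case F: (repr _) => [m' w'].
have /lfracP [a aW rE] : lfrac r' s' = lfrac r s by rewrite /lfrac -E reprK.
have /lfracP [b bW mE] : lfrac m' w' = lfrac m w by rewrite /lfrac -F reprK.
apply/lfracP; exists (a * b ^+ (p ^ e)); first by rewrite rpredM ?rpredX.
have {}rE : a * (sval s * r') = a * (sval s' * r) := rE.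
move: mE; rewrite /= !scalerA !tensorZl => mE.
have -> : a * b ^+ (p ^ e) * (sval s * sval w ^+ (p ^ e)) * r' =
  a * (sval s * r') * phi (b * sval w) by rewrite /phi /frob exprMn; ring.
rewrite rE -tensorZr mE tensorZr; congr tensor.
by rewrite /= /frob exprMn; ring.
Qed.

(** Converse of [frob_pow_loc]: [loc_tensor] is balanced, so it carries the relation to F^e(M)_W,
    where (N_W)^[q] lands in the localization of N^[q]; clearing denominators there gives v. *)
Lemma frob_pow_loc_ex (r : R) (u : M) (w t : denom W) :
  (lfrac (r : R^o) t : locring W) *: frob_elt chWp e (lfrac u w) \in
    frob_pow chWp e (loc_pred W N) ->
  exists2 v, v \in W & v *: (r *: frob_elt chRp e u) \in frob_pow chRp e N.
Proof.
case/frob_powP => l lN; rewrite tensorZl mulr1 => lE.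
have : \sum_(sm <- [:: (lfrac (r : R^o) t, lfrac u w)]) loc_tensor sm.1 sm.2 =
    \sum_(sm <- l) loc_tensor sm.1 sm.2.
  apply: (tensor_eq_sum (phi := phiW)); last 1 first.
  - by apply/tensorP; rewrite (tensors_sum _ l) -lE.
  - move=> a b x; have [[r1 s1] ->] := lfrac_ex a.
    have [[r2 s2] ->] := lfrac_ex b; have [[m v] ->] := lfrac_ex x.
    rewrite lfracD !loc_tensorE lfracD; apply: lfrac_eq => /=.
    rewrite !scalerDr !scalerA !tensorZl -!tensorDl; congr tensor.
    by rewrite /GRing.scale /=; ring.
  - move=> a x y; have [[r1 s1] ->] := lfrac_ex a.
    have [[m1 v1] ->] := lfrac_ex x; have [[m2 v2] ->] := lfrac_ex y.
    rewrite lfracD !loc_tensorE lfracD; apply: lfrac_eq => /=.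
    rewrite tensorDr !scalerDr !tensorZr !scalerA !tensorZl.
    by congr (_ + _); congr tensor; rewrite /= /frob !exprMn; ring.
  - move=> a b x; have [[r1 s1] ->] := lfrac_ex a.
    have [[r2 s2] ->] := lfrac_ex b; have [[m v] ->] := lfrac_ex x.
    have -> :
      (lfrac r1 s1 : locring W) * frob chWp e (lfrac r2 s2 : locring W) =
        lfrac ((r1 : R) * phi r2 : R^o) (denomM s1 (denomX s2 (p ^ e))).
      by rewrite -lfracM -lfracX.
    rewrite [_ *: lfrac m v]loc_scaleE !loc_tensorE; apply: lfrac_eq => /=.
    rewrite tensorZr !tensorZl; congr tensor.
    by rewrite /= /phi /frob /GRing.scale /= !exprMn; ring.
rewrite big_seq1 /= loc_tensorE => lE'.
have : \sum_(sm <- l) loc_tensor sm.1 sm.2 \in loc_pred W (frob_pow chRp e N).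
  rewrite big_seq rpred_sum // => -[a x] /(allP lN) /= /asboolP[n nN [v ->]].
  have [[s b] ->] := lfrac_ex a; rewrite loc_tensorE; apply/asboolP.
  exists (tensor phi (s : R) n); first exact: mem_frob_pow_tensor.
  by eexists.
rewrite -lE' => /asboolP[y yN [v /lfracP[s sW E]]].
(* Here v is the denominator of the fraction with numerator y in N^[q], and s witnesses the equality
   of the two fractions. *)
exists (s * sval v); first by rewrite rpredM // (svalP v).
by rewrite tensorZl mulr1 -scalerA E !rpredZ.
Qed.

End FrobeniusLocalization.

(** * Finite generation of M_W and N_W, required to apply test elements of R_P *)

Section FiniteGeneration.
Variables (R : comPzRingType) (W : mulrClosed R) (M : lmodType R).

Lemma lfrac_sum (I : Type) (l : seq I) (f : I -> M) (w : denom W) :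
  lfrac (\sum_(i <- l) f i) w = \sum_(i <- l) lfrac (f i) w.
Proof.
elim: l => [|i l IHl]; last first.
  rewrite !big_cons -IHl lfracD; apply: lfrac_eq; rewrite /= -scalerDr.
  by rewrite scalerA.
by rewrite !big_nil; apply: lfrac_eq; rewrite !scaler0.
Qed.

Lemma finitely_generated_loc :
  finitely_generated M -> finitely_generated (locmod W M).
Proof.
move=> [s sM]; exists [seq lfrac m (denom1 W) | m <- s] => x.
rewrite size_map.
have [[u w] ->] := lfrac_ex x; have [a ->] := sM u.
(* The denominator of u / w goes into each coefficient. *)
exists (fun i => lfrac (a i : R^o) w : locring W).
rewrite lfrac_sum; apply: eq_bigr => i _.
rewrite (nth_map 0) // [RHS]loc_scaleE; apply: lfrac_eq.
by rewrite /= mulr1.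
Qed.

Lemma finitely_generated_loc_sub (N : submodClosed M) :
  finitely_generated (submodule N) ->
  finitely_generated (submodule (loc_pred W N : submodClosed (locmod W M))).
Proof.
move=> [s sN].
have memW (n : submodule N) : lfrac (val n) (denom1 W) \in loc_pred W N.
  by apply/asboolP; exists (val n); [exact: valP | exists (denom1 W)].
pose g n : submodule (loc_pred W N : submodClosed (locmod W M)) :=
  exist _ (lfrac (val n) (denom1 W)) (memW n).
exists [seq g n | n <- s] => -[x xN]; rewrite size_map.
have /asboolP[u uN [w xE]] := xN.
have [a aE] := sN (exist _ u uN).
exists (fun i => lfrac (a i : R^o) w : locring W).
apply: val_inj; rewrite raddf_sum /= xE.
have -> : u = \sum_(i < size s) a i *: val s`_i.
  by rewrite -[u]/(val (exist _ u uN : submodule N)) aE raddf_sum.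
rewrite lfrac_sum; apply: eq_bigr => i _.
rewrite (nth_map 0) // [RHS]loc_scaleE; apply: lfrac_eq.
by rewrite /= mulr1.
Qed.

End FiniteGeneration.

(** * Tight closure under localization *)

Section TightClosureLocalization.
Variables (R : comPzRingType) (p : nat) (chRp : p \in pzchar R).
Variables (M : lmodType R) (N : submodClosed M).

Lemma tight_closure_loc (W : mulrClosed R) (u : M) (w : denom W) :
  u \in tight_closure chRp N ->
  lfrac u w \in tight_closure (pzchar_loc W chRp) (loc_pred W N).
Proof.
move=> /asboolP[c c_off [e0 cu]]; apply/asboolP; exists (to_loc W c).
  by apply/off_minimal_primes_lfrac => P Pmin _; exact: c_off.
exists e0 => e /cu cuN; apply: (frob_pow_loc _ _ (rpred1 W)).
by rewrite scale1r.
Qed.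

(** If the multiplier over R_W is c / t, then c avoids the minimal primes missing W, in particular
    those missing the larger V, so c / 1 is a multiplier over R_V. It is applied with V the
    complement of a prime. *)
Lemma tight_closure_loc_sub (W V : mulrClosed R) (u : M) (w : denom W)
    (v : denom V) :
  {subset W <= V} ->
  lfrac u w \in tight_closure (pzchar_loc W chRp) (loc_pred W N) ->
  lfrac u v \in tight_closure (pzchar_loc V chRp) (loc_pred V N).
Proof.
move=> WV /asboolP[a]; have [[c t] ->] := lfrac_ex a.
move=> /off_minimal_primes_lfrac c_off [e0 cu]; apply/asboolP.
exists (to_loc V c).
  apply/off_minimal_primes_lfrac => P Pmin PV; apply: c_off => // s /WV.
  exact: PV.
exists e0 => e /cu /frob_pow_loc_ex[s /WV sV sN].
exact: (frob_pow_loc _ _ sV sN).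
Qed.

Lemma locally_stable_frob_pow (c : R) (W : mulrClosed R) (u : M) (w : denom W)
    (e : nat) :
  finitely_generated M -> finitely_generated (submodule N) ->
  locally_stable chRp c ->
  lfrac u w \in tight_closure (pzchar_loc W chRp) (loc_pred W N) ->
  exists2 v, v \in W & v *: (c *: frob_elt chRp e u) \in frob_pow chRp e N.
Proof.
move=> fgM fgN c_stable uN; apply: contrapT => noW.
(* The colon ideal of N^[q] by c u^q; if it misses W, it sits in a prime P missing W. *)
pose I : pred R := fun r => r *: (c *: frob_elt chRp e u) \in frob_pow chRp e N.
have IE r : (r \in I) = (r *: (c *: frob_elt chRp e u) \in frob_pow chRp e N).
  by [].
have [|P IP PW] := @disjoint_ideal_sub_prime R W I.
  split; first split; first by rewrite IE scale0r rpred0.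
    move=> a x y; rewrite !IE => xI yI.
    by rewrite scalerDl -scalerA rpredD // rpredZ.
  by move=> s sW; apply/negP => sI; apply: noW; exists s.
have WP : {subset W <= prime_compl P} by move=> s /PW; rewrite inE.
have uP := tight_closure_loc_sub (denom1 (prime_compl P)) WP uN.
have [_ /(_ _ (loc_pred (prime_compl P) N))] := c_stable P.
move=> /(_ (finitely_generated_loc _ fgM) (finitely_generated_loc_sub _ fgN)).
move=> /(_ (lfrac u (denom1 _)))[/(_ uP)/(_ e) cuP _].
(* Since c / 1 is a test element of R_P, some s outside P lies in I, contradicting that P contains
   I. *)
have [s sP sI] := frob_pow_loc_ex cuP.
by move: sP; rewrite inE /= (IP s sI).
Qed.

End TightClosureLocalization.

Theorem proposition2p3 (R : comNzRingType) (p : nat) (chRp : p \in [pchar R])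
  (redR : reduced R) (noethR : noetherian R)
  (M : lmodType R) (N : submodClosed M)
  (fgM : finitely_generated M) (fgN : finitely_generated (submodule N))
  (c : R) (c_test : test_element chRp c) (c_stable : locally_stable chRp c)
  (test_exp : exists e : nat, test_exponent chRp c N e)
  (W : mulrClosed R) :
  tight_closure (pzchar_loc W chRp) (loc_pred W N) =i
    loc_pred W (tight_closure chRp N).
Proof.
have [e c_exp] := test_exp.
move=> x; apply/idP/idP => [|/asboolP[u uN [w ->]]]; last first.
  exact: tight_closure_loc.
have [[u w] ->] := lfrac_ex x => uN.
have [v vW vN] := locally_stable_frob_pow e fgM fgN c_stable uN.
apply/asboolP; exists (v *: u).
  have p_gt0 : (0 < p ^ e)%N.
    by case/andP: (chRp) => p_pr _; rewrite expn_gt0 prime_gt0.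
  (* The test exponent is used at Q = q itself, with c (v u)^q = v^(q-1) (v c u^q). *)
  apply: (c_exp _ e) => //; rewrite scale_frob_elt -(prednK p_gt0) exprSr.
  by rewrite scalerA mulrCA -scalerA [c * v]mulrC -scalerA rpredZ.
exists (denomM (exist _ v vW) w); apply: lfrac_eq => /=.
by rewrite scalerA mulrC.
Qed.
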